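(* Let $\mathcal{D}_\xi=\hat{\mathcal{P}}^{-1}\mathcal{Q}_\xi$ and $\mathcal{D}_\eta=\hat{\mathcal{P}}^{-1}\mathcal{Q}_\eta$ be summation-by-parts operators on the reference square $\hat\Omega=[0,1]^2$, i.e. $$\mathcal{Q}_\xi+\mathcal{Q}_\xi^\top=E^\top\hat P N_\xi E,\qquad \mathcal{Q}_\eta+\mathcal{Q}_\eta^\top=E^\top\hat P N_\eta E .$$ Let $\boldsymbol{X}_\xi,\boldsymbol{X}_\eta,\boldsymbol{Y}_\xi,\boldsymbol{Y}_\eta$ and $\boldsymbol{x}_\xi,\boldsymbol{x}_\eta,\boldsymbol{y}_\xi,\boldsymbol{y}_\eta$ be vectors of (exact or approximate) volume, respectively surface, nodal values of the metric coefficients $x_\xi,x_\eta,y_\xi,y_\eta$. Define $$\tilde{\mathcal{Q}}_x=\tfrac12\big(\mathcal{Q}_\xi\underline{\boldsymbol{Y}_\eta}+\underline{\boldsymbol{Y}_\eta}\mathcal{Q}_\xi-\mathcal{Q}_\eta\underline{\boldsymbol{Y}_\xi}-\underline{\boldsymbol{Y}_\xi}\mathcal{Q}_\eta\big),\qquad \tilde{\mathcal{Q}}_y=\tfrac12\big(\mathcal{Q}_\eta\underline{\boldsymbol{X}_\xi}+\underline{\boldsymbol{X}_\xi}\mathcal{Q}_\eta-\mathcal{Q}_\xi\underline{\boldsymbol{X}_\eta}-\underline{\boldsymbol{X}_\eta}\mathcal{Q}_\xi\big),$$ $$\mathcal{Q}_x=\tilde{\mathcal{Q}}_x+\tfrac12E^\top\hat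 P\Big[N_\xi\big(\underline{\boldsymbol{y}_\eta}E-E\underline{\boldsymbol{Y}_\eta}\big)-N_\eta\big(\underline{\boldsymbol{y}_\xi}E-E\underline{\boldsymbol{Y}_\xi}\big)\Big],$$ $$\mathcal{Q}_y=\tilde{\mathcal{Q}}_y+\tfrac12E^\top\hat P\Big[N_\eta\big(\underline{\boldsymbol{x}_\xi}E-E\underline{\boldsymbol{X}_\xi}\big)-N_\xi\big(\underline{\boldsymbol{x}_\eta}E-E\underline{\boldsymbol{X}_\eta}\big)\Big],$$ and $$P=\underline{\boldsymbol{j}}\hat P,\qquad N_x=\underline{\boldsymbol{j}}^{-1}\big(N_\xi\underline{\boldsymbol{y}_\eta}-N_\eta\underline{\boldsymbol{y}_\xi}\big),\qquad N_y=\underline{\boldsymbol{j}}^{-1}\big(N_\eta\underline{\boldsymbol{x}_\xi}-N_\xi\underline{\boldsymbol{x}_\eta}\big).$$ Then $\mathcal{D}_x=\mathcal{P}^{-1}\mathcal{Q}_x$ and $\mathcal{D}_y=\mathcal{P}^{-1}\mathcal{Q}_y$ with $\mathcal{P}=\underline{\boldsymbol{J}}\hat{\mathcal{P}}$ satisfy the summation-by-parts property on the physical domain: $$\mathcal{Q}_x+\mathcal{Q}_x^\top=E^\top PN_xE,\qquad \mathcal{Q}_y+\mathcal{Q}_y^\top=E^\top PN_yE .$$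
   Context: All matrices are real. The physical domain $\Omega$ is the image of $\hat\Omega=[0,1]^2$ under a curvilinear map $x=x(\xi,\eta)$, $y=y(\xi,\eta)$. There are $N_v$ volume nodes and $N_s$ surface nodes; $\hat{\mathcal{P}}>0$ ($N_v\times N_v$) and $\hat P>0$ ($N_s\times N_s$) are diagonal matrices of quadrature weights on $\hat\Omega$ and $\partial\hat\Omega$; $N_\xi,N_\eta$ are $N_s\times N_s$ diagonal matrices containing the components of the outward unit normal of $\hat\Omega$ at the surface nodes ($N_\xi=+1,-1,0,0$ and $N_\eta=0,0,+1,-1$ on the East, West, North, South faces respectively); $E$ is an $N_s\times N_v$ matrix (projection from volume nodes to surface nodes; surface nodes need not be volume nodes). For a vector $\boldsymbol{a}$, $\underline{\boldsymbol{a}}$ is the diagonal matrix with $\boldsymbol{a}$ on the diagonal. $\boldsymbol{J}\in\mathbb{R}^{N_v}$ contains the (positive) volume nodal values of the Jacobian determinant $J=x_\xi y_\eta-y_\xi x_\eta$, and $\boldsymbol{j}\in\mathbb{R}^{N_s}$ contains the (positive) exact or approximate surface nodal values of the stretching factor $j=\sqrt{x_\eta^2+y_\eta^2}$ on the East and West faces, $j=\sqrt{x_\xi^2+y_\xi^2}$ on the North and South faces. *)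

(* Defs.v *)
From HB Require Import structures.
From mathcomp Require Import all_boot all_order all_algebra.
From mathcomp Require Import all_classical all_reals all_analysis.
Set Implicit Arguments.
Unset Strict Implicit.
Unset Printing Implicit Defensive.
Import Order.TTheory GRing.Theory Num.Theory.
Import numFieldNormedType.Exports.
Local Open Scope classical_set_scope.
Local Open Scope ring_scope.

(* The increments h keep a + h inside [0, 1], so the derivative is one-sided at
   0 and 1 and the values of f outside [0, 1] are irrelevant. *)
Definition has_derivative01 (R : realType) (f : R -> R) (a l : R) : Prop :=
  h^-1 * (f (a + h) - f a)
    @[h --> within [set h : R | 0 <= a + h <= 1] 0^'] --> l.

Definition unit_square (R : realType) : set (R * R) :=
  [set z | (0 <= z.1 <= 1) /\ (0 <= z.2 <= 1)].

(* A map (cx, cy) of the reference square, with its metric coefficients. *)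
Record curvilinear_map (R : realType) := CurvilinearMap {
  cx : R -> R -> R;
  cy : R -> R -> R;
  cx_xi : R -> R -> R;
  cx_eta : R -> R -> R;
  cy_xi : R -> R -> R;
  cy_eta : R -> R -> R;
  cx_xiP : forall z, unit_square z ->
    has_derivative01 (fun s => cx s z.2) z.1 (cx_xi z.1 z.2);
  cx_etaP : forall z, unit_square z ->
    has_derivative01 (fun t => cx z.1 t) z.2 (cx_eta z.1 z.2);
  cy_xiP : forall z, unit_square z ->
    has_derivative01 (fun s => cy s z.2) z.1 (cy_xi z.1 z.2);
  cy_etaP : forall z, unit_square z ->
    has_derivative01 (fun t => cy z.1 t) z.2 (cy_eta z.1 z.2)
}.

Definition jacobian_det (R : realType) (m : curvilinear_map R) (z : R * R) : R :=
  cx_xi m z.1 z.2 * cy_eta m z.1 z.2 - cy_xi m z.1 z.2 * cx_eta m z.1 z.2.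

Inductive face := East | West | North | South.

Definition on_face (R : realType) (f : face) (z : R * R) : Prop :=
  match f with
  | East => z.1 = 1 /\ 0 <= z.2 <= 1
  | West => z.1 = 0 /\ 0 <= z.2 <= 1
  | North => z.2 = 1 /\ 0 <= z.1 <= 1
  | South => z.2 = 0 /\ 0 <= z.1 <= 1
  end.

Definition normal_xi (R : realType) (f : face) : R :=
  match f with East => 1 | West => -1 | North => 0 | South => 0 end.

Definition normal_eta (R : realType) (f : face) : R :=
  match f with East => 0 | West => 0 | North => 1 | South => -1 end.

Definition posdiag_mx (R : realType) (n : nat) (A : 'M[R]_n) : Prop :=
  is_diag_mx A /\ (forall i, 0 < A i i).

(* D = V^-1 Q, where V holds the volume quadrature weights, P the surface
   quadrature weights, N one component of the outward normal at the surface
   nodes, and E projects from volume to surface nodes.  Positivity of V makes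
   invmx V a genuine inverse. *)
Definition sbp_operator (R : realType) (Nv Ns : nat)
    (V : 'M[R]_Nv) (P : 'M[R]_Ns) (E : 'M[R]_(Ns, Nv))
    (N : 'M[R]_Ns) (Q D : 'M[R]_Nv) : Prop :=
  [/\ posdiag_mx V, posdiag_mx P, D = invmx V *m Q
    & Q + Q^T = E^T *m P *m N *m E].

(* Main.v *)
Require Import Defs.
From HB Require Import structures.
From mathcomp Require Import all_boot all_order all_algebra.
From mathcomp Require Import all_classical all_reals all_analysis.
From mathcomp Require Import ring.
Set Implicit Arguments.
Unset Strict Implicit.
Unset Printing Implicit Defensive.
Import Order.TTheory GRing.Theory Num.Theory.
Import numFieldNormedType.Exports.
Local Open Scope classical_set_scope.
Local Open Scope ring_scope.

(** Multiplication by a metric coefficient turns a reference derivative into a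
    physical one, and the split form (Q A + A Q) / 2 is the choice for which this
    respects summation by parts in the volume.  If Q + Q^T = B with
    B = E^T P N E and A is diagonal, then the symmetric part of Q A + A Q is
    (B A + A B) / 2: only the boundary form B of Q survives, but the coefficient
    is sampled at volume nodes.  The boundary correction
    E^T P N (a E - E A) equals E^T P N a E - B A; when the sum with
    the transpose is taken, - B A and - A B cancel B A + A B, which leaves twice
    E^T P N a E, the boundary form whose coefficient is sampled at surface nodes
    ([split_form_sbp]).  The cancellation is exact for arbitrary nodal vectors,
    so for this identity approximate metric coefficients are as good as exact
    ones.

    Each physical operator is half the difference of two such corrected split
    forms, one per reference direction, and the stretching factor in the surface
    weights cancels its inverse in the physical normal
    ([physical_sbp_operator]).  The y-operator is the x-operator with the two
    reference directions exchanged, so a single lemma yields both halves. *)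

(** Symmetry of W a, where W stands for P N, is what makes the transposed
    correction contribute a second copy of the boundary form; when W and a are
    themselves symmetric it says that they commute. *)
Lemma split_form_sbp (R : comPzRingType) (n s : nat) (E : 'M[R]_(s, n))
    (W a : 'M[R]_s) (Q A : 'M[R]_n) :
  A^T = A -> (W *m a)^T = W *m a -> Q + Q^T = E^T *m W *m E ->
  let S := Q *m A + A *m Q + E^T *m W *m (a *m E - E *m A) in
  S + S^T = (E^T *m (W *m a) *m E) *+ 2.
Proof.
move=> symA symWa sbpQ S.
set B := E^T *m W *m E in sbpQ; set T := E^T *m (W *m a) *m E.
have symB : B^T = B by rewrite -sbpQ linearD /= trmxK addrC.
have symT : T^T = T by rewrite /T !trmx_mul trmxK -trmx_mul symWa !mulmxA.
have -> : S = Q *m A + A *m Q + (T - B *m A).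
  by rewrite /S /T /B mulmxBr !mulmxA.
clearbody B T.
have -> : (Q *m A + A *m Q + (T - B *m A))^T
          = A *m Q^T + Q^T *m A + (T - A *m B).
  by rewrite !linearD linearN /= !trmx_mul symA symB symT.
have -> : B *m A = Q *m A + Q^T *m A by rewrite -sbpQ mulmxDl.
have -> : A *m B = A *m Q + A *m Q^T by rewrite -sbpQ mulmxDr.
rewrite mulr2n; move: (Q *m A) (A *m Q) (Q^T *m A) (A *m Q^T) => p q r t.
by apply/matrixP=> i k; rewrite !mxE; ring.
Qed.

Lemma posdiag_mx_scale (R : realType) (n : nat) (d : 'rV[R]_n) (A : 'M[R]_n) :
  (forall i, 0 < d 0 i) -> posdiag_mx A -> posdiag_mx (diag_mx d *m A).
Proof.
move=> d_gt0 [/diag_mxP[e ->] e_gt0]; split.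
  by rewrite mulmx_diag; exact: diag_mx_is_diag.
move=> i; move: (e_gt0 i); rewrite mul_diag_mx !mxE eqxx mulr1n => ei_gt0.
by rewrite mulr_gt0.
Qed.

Lemma unitmx_diag_gt0 (R : realType) (n : nat) (d : 'rV[R]_n) :
  (forall i, 0 < d 0 i) -> diag_mx d \in unitmx.
Proof.
move=> d_gt0; rewrite unitmxE det_diag unitfE.
by apply/prodf_neq0 => i _; rewrite gt_eqF.
Qed.

(** The labels 1 and 2 are the two reference directions in either order:
    (xi, eta) gives the x-derivative and (eta, xi) the y-derivative. *)
Lemma physical_sbp_operator (R : realType) (Nv Ns : nat)
    (V : 'M[R]_Nv) (P : 'M[R]_Ns) (E : 'M[R]_(Ns, Nv))
    (J A1 A2 : 'rV[R]_Nv) (j n1 n2 a1 a2 : 'rV[R]_Ns)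
    (Q1 Q2 D1 D2 : 'M[R]_Nv) :
  (forall i, 0 < J 0 i) -> (forall k, 0 < j 0 k) ->
  sbp_operator V P E (diag_mx n1) Q1 D1 ->
  sbp_operator V P E (diag_mx n2) Q2 D2 ->
  let Q := 2^-1 *: (Q1 *m diag_mx A1 + diag_mx A1 *m Q1
                    - Q2 *m diag_mx A2 - diag_mx A2 *m Q2)
           + 2^-1 *: (E^T *m P *m
               (diag_mx n1 *m (diag_mx a1 *m E - E *m diag_mx A1)
                - diag_mx n2 *m (diag_mx a2 *m E - E *m diag_mx A2))) in
  sbp_operator (diag_mx J *m V) (diag_mx j *m P) E
    (invmx (diag_mx j) *m (diag_mx n1 *m diag_mx a1 - diag_mx n2 *m diag_mx a2))
    Q (invmx (diag_mx J *m V) *m Q).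
Proof.
move=> J_gt0 j_gt0 [posV posP _ sbp1] [_ _ _ sbp2] Q.
split; [exact: posdiag_mx_scale | exact: posdiag_mx_scale | by [] | ].
case: posP => /diag_mxP[p defP] _.
have symW (n a : 'rV[R]_Ns) :
    (P *m diag_mx n *m diag_mx a)^T = P *m diag_mx n *m diag_mx a.
  by rewrite defP !mulmx_diag tr_diag_mx.
have jK : diag_mx j *m P *m invmx (diag_mx j) = P.
  by rewrite defP diag_mxC mulmxK // unitmx_diag_gt0.
have /= split1 := split_form_sbp (tr_diag_mx A1) (symW n1 a1)
  (etrans sbp1 (congr1 (mulmx^~ E) (esym (mulmxA _ _ _)))).
have /= split2 := split_form_sbp (tr_diag_mx A2) (symW n2 a2)
  (etrans sbp2 (congr1 (mulmx^~ E) (esym (mulmxA _ _ _)))).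
set S1 := (X in X + X^T = _) in split1; set S2 := (X in X + X^T = _) in split2.
have -> : Q = 2^-1 *: (S1 - S2).
  rewrite /Q /S1 /S2 -scalerDr; congr (_ *: _).
  rewrite mulmxBr !mulmxA opprD opprD !addrA.
  by apply/matrixP=> i k; rewrite !mxE; ring.
rewrite linearZ -scalerDr linearB /= addrACA -opprD split1 split2 -mulrnBl.
rewrite -(scaler_nat 2 (_ - _)) scalerA mulVf ?pnatr_eq0 // scale1r.
rewrite -mulmxBl -mulmxBr; congr (_ *m E).
by rewrite -!(mulmxA P) -mulmxBr -(mulmxA E^T) (mulmxA (_ *m P)) jK.
Qed.

Theorem proposition2 (R : realType) (Nv Ns : nat)
  (m : curvilinear_map R)
  (vnode : 'I_Nv -> R * R) (hvnode : forall i, unit_square (vnode i))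
  (snode : 'I_Ns -> R * R) (sface : 'I_Ns -> face)
  (hsnode : forall k, on_face (sface k) (snode k))
  (Vhat : 'M[R]_Nv) (Phat : 'M[R]_Ns)
  (E : 'M[R]_(Ns, Nv))
  (J : 'rV[R]_Nv) (hJ : forall i, J 0 i = jacobian_det m (vnode i))
  (hJ_gt0 : forall i, 0 < J 0 i)
  (j : 'rV[R]_Ns) (hj_gt0 : forall k, 0 < j 0 k)
  (X_xi X_eta Y_xi Y_eta : 'rV[R]_Nv)
  (x_xi x_eta y_xi y_eta : 'rV[R]_Ns)
  (Q_xi Q_eta D_xi D_eta : 'M[R]_Nv) :
  let N_xi := diag_mx (\row_k normal_xi R (sface k)) in
  let N_eta := diag_mx (\row_k normal_eta R (sface k)) in
  sbp_operator Vhat Phat E N_xi Q_xi D_xi ->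
  sbp_operator Vhat Phat E N_eta Q_eta D_eta ->
  let Qt_x := 2^-1 *: (Q_xi *m diag_mx Y_eta + diag_mx Y_eta *m Q_xi
                       - Q_eta *m diag_mx Y_xi - diag_mx Y_xi *m Q_eta) in
  let Qt_y := 2^-1 *: (Q_eta *m diag_mx X_xi + diag_mx X_xi *m Q_eta
                       - Q_xi *m diag_mx X_eta - diag_mx X_eta *m Q_xi) in
  let Q_x := Qt_x + 2^-1 *: (E^T *m Phat *m
        (N_xi *m (diag_mx y_eta *m E - E *m diag_mx Y_eta)
         - N_eta *m (diag_mx y_xi *m E - E *m diag_mx Y_xi))) in
  let Q_y := Qt_y + 2^-1 *: (E^T *m Phat *m
        (N_eta *m (diag_mx x_xi *m E - E *m diag_mx X_xi)
         - N_xi *m (diag_mx x_eta *m E - E *m diag_mx X_eta))) in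
  let P := diag_mx j *m Phat in
  let N_x := invmx (diag_mx j) *m
             (N_xi *m diag_mx y_eta - N_eta *m diag_mx y_xi) in
  let N_y := invmx (diag_mx j) *m
             (N_eta *m diag_mx x_xi - N_xi *m diag_mx x_eta) in
  let V := diag_mx J *m Vhat in
  let D_x := invmx V *m Q_x in
  let D_y := invmx V *m Q_y in
  sbp_operator V P E N_x Q_x D_x /\ sbp_operator V P E N_y Q_y D_y.
Proof.
move=> N_xi N_eta sbp_xi sbp_eta Qt_x Qt_y Q_x Q_y P N_x N_y V D_x D_y.
split.
  exact: physical_sbp_operator hJ_gt0 hj_gt0 sbp_xi sbp_eta.
exact: physical_sbp_operator hJ_gt0 hj_gt0 sbp_eta sbp_xi.
Qed.
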